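(* Let $P_1$ and $P_2$ be two punctured Preparata codes of the same length $n$. Then the minimal distance graphs of $P_1$ and $P_2$ are isomorphic if and only if $P_1$ and $P_2$ are isometric, i.e. there exists a map $I:P_1\to P_2$ with $d(I(x),I(y))=d(x,y)$ for all $x,y\in P_1$.
   Context: $E^n$ is the set of binary vectors of length $n$ with the Hamming distance $d$. A Preparata code is a binary code of length $2^m$ ($m\ge 4$ even) with minimum distance $6$ and maximum possible cardinality among binary codes of that length and minimum distance. A punctured Preparata code is obtained from a Preparata code by deleting one coordinate; it has length $n=2^m-1$ and minimum distance (code distance) $5$. The minimal distance graph of a code $C$ with code distance $d_C$ has the codewords of $C$ as vertices, two vertices being adjacent iff their Hamming distance equals $d_C$. *)

(* Defs.v *)
From mathcomp Require Import all_boot.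
Set Implicit Arguments. Unset Strict Implicit. Unset Printing Implicit Defensive.

Definition vec (n : nat) := {ffun 'I_n -> bool}.

Definition hdist (n : nat) (x y : vec n) : nat := #|[set i | x i != y i]|.

Definition code (n : nat) := {set vec n}.

Definition has_min_dist (n : nat) (C : code n) (d : nat) : Prop :=
  (exists x y, [/\ x \in C, y \in C, x != y & hdist x y = d]) /\
  (forall x y, x \in C -> y \in C -> x != y -> d <= hdist x y).

(* Code distance d_C (the minimum distance between distinct codewords;
   equals n.+1 by convention if C has fewer than two codewords). *)
Definition code_dist (n : nat) (C : code n) : nat :=
  \big[minn/n.+1]_(x in C) \big[minn/n.+1]_(y in C | y != x) hdist x y.

Definition is_preparata (N : nat) (C : code N) : Prop :=
  (exists m, [/\ ~~ odd m, 4 <= m & N = 2 ^ m]) /\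
  has_min_dist C 6 /\
  (forall C' : code N, has_min_dist C' 6 -> #|C'| <= #|C|).

Definition puncture (n : nat) (i : 'I_n.+1) (x : vec n.+1) : vec n :=
  [ffun j => x (lift i j)].

Definition puncture_code (n : nat) (i : 'I_n.+1) (C : code n.+1) : code n :=
  [set puncture i x | x in C].

Definition is_punctured_preparata (n : nat) (P : code n) : Prop :=
  exists (C : code n.+1) (i : 'I_n.+1), is_preparata C /\ P = puncture_code i C.

Definition min_dist_graph_iso (n : nat) (C1 C2 : code n) : Prop :=
  exists f : vec n -> vec n,
    [/\ {in C1 &, injective f}, f @: C1 = C2 &
        forall x y, x \in C1 -> y \in C1 ->
          (hdist x y == code_dist C1) = (hdist (f x) (f y) == code_dist C2)].

Definition isometric (n : nat) (C1 C2 : code n) : Prop :=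
  exists I : vec n -> vec n,
    (forall x, x \in C1 -> I x \in C2) /\
    (forall x y, x \in C1 -> y \in C1 -> hdist (I x) (I y) = hdist x y).

(* Main.v *)
Require Import Defs.
From mathcomp Require Import all_boot all_algebra all_field zify ring.
Set Implicit Arguments. Unset Strict Implicit. Unset Printing Implicit Defensive.

(** The Baker - van Lint - Wilson construction over GF(2^(m-1)) shows that a punctured Preparata
    code P attains the Johnson bound.  Equality in that bound forces, at every codeword x, each
    pair of coordinates to lie in exactly one triple that is not contained in a block, a block
    being the difference set of x and a codeword at distance 5; moreover two blocks share at most
    two coordinates.

    Let f be an isomorphism of the minimal distance graphs that preserves all distances below k,
    and let d(x, y) = k >= 6.  Counting triples inside the difference set of x and y shows that
    many neighbours u of y satisfy d(x, u) < k.  If d(f x, f y) = k' > k, the images of these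
    neighbours correspond to blocks meeting a k'-set in at least 4 points, and a packing bound
    shows that there are too few of them.  Hence f preserves distance k as well. *)

(** * Hamming space *)

Section Hamming.
Variable n : nat.
Implicit Types (x y z v : vec n) (A B : {set 'I_n}).

Definition diff x y : {set 'I_n} := [set i | x i != y i].

(** Inverse of [diff x]: seen from [x], words become subsets of the coordinates. *)
Definition shift x A : vec n := [ffun i => x i (+) (i \in A)].

Lemma hdistE x y : hdist x y = #|diff x y|. Proof. by []. Qed.

Lemma diff_shift x A : diff x (shift x A) = A.
Proof. by apply/setP=> i; rewrite inE ffunE; case: (x i); case: (i \in A). Qed.

Lemma shift_diff x y : shift x (diff x y) = y.
Proof. by apply/ffunP=> i; rewrite ffunE inE; case: (x i); case: (y i). Qed.

Lemma hdist_shift x A : hdist x (shift x A) = #|A|.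
Proof. by rewrite hdistE diff_shift. Qed.

Lemma hdistC x y : hdist x y = hdist y x.
Proof. by apply: eq_card => i; rewrite !inE eq_sym. Qed.

Lemma hdistxx x : hdist x x = 0.
Proof. by apply: eq_card0 => i; rewrite !inE eqxx. Qed.

Lemma hdist_eq0 x y : (hdist x y == 0) = (x == y).
Proof.
apply/eqP/eqP=> [/cards0_eq d0|->]; last exact: hdistxx.
by rewrite -(shift_diff x y) /diff d0; apply/ffunP=> i; rewrite ffunE inE addbF.
Qed.

(** [diff y z] is the symmetric difference of [diff x y] and [diff x z]; the additive form avoids
    truncated subtraction. *)
Lemma hdist_inter x y z :
  hdist y z + 2 * #|diff x y :&: diff x z| = hdist x y + hdist x z.
Proof.
rewrite !hdistE -(cardsID (diff x z) (diff x y)) -(cardsID (diff x y) (diff x z)).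
have -> : diff y z = (diff x y :\: diff x z) :|: (diff x z :\: diff x y).
  by apply/setP=> i; rewrite !inE; case: (x i); case: (y i); case: (z i).
rewrite cardsU (_ : _ :&: (_ :\: _) = set0) ?cards0; first by rewrite setIC; lia.
by apply/setP=> i; rewrite !inE; case: (x i != y i); case: (x i != z i).
Qed.

Lemma hdist_triangle x y z : hdist y z <= hdist x y + hdist x z.
Proof. by have := hdist_inter x y z; lia. Qed.

Lemma card_shift x (Q : pred {set 'I_n}) :
  #|[set v | Q (diff x v)]| = #|[set A | Q A]|.
Proof.
rewrite -(card_imset _ (can_inj (diff_shift x))); apply: eq_card => v.
rewrite inE; apply/idP/imsetP=> [Qv|[A]].
  by exists (diff x v); rewrite ?inE ?shift_diff.
by rewrite inE => QA ->; rewrite diff_shift.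
Qed.

End Hamming.

Lemma card_succ_between (T : finType) (p w : {set T}) : p \subset w ->
  #|[set A : {set T} | [&& p \subset A, A \subset w & #|A| == #|p|.+1]]| = #|w| - #|p|.
Proof.
move=> pw; rewrite -cardsDS // -(@card_in_imset _ _ (fun i => i |: p) (w :\: p)).
  apply: eq_card => A; rewrite inE; apply/and3P/imsetP=> [[pA Aw /eqP cA]|[i]].
    have /cards1P[i Ai] : #|A :\: p| == 1 by rewrite cardsDS // cA subSnn.
    exists i; last by rewrite -Ai setUC -{1}(setIidPr pA) setID.
    have: i \in A :\: p by rewrite Ai inE.
    by rewrite !inE => /andP[-> iA]; rewrite (subsetP Aw).
  rewrite inE => /andP[ip iw] ->; split; first exact: subsetUr.
    by rewrite subUset sub1set iw.
  by rewrite cardsU1 ip.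
move=> i j /[!inE] /andP[ip _] /andP[jp _] e.
have: i \in j |: p by rewrite -e setU11.
by rewrite !inE (negbTE ip) orbF => /eqP.
Qed.

(** * Equality in the Johnson bound *)

Section Packing.
Variables (n : nat) (P : code n).
Hypothesis P_dist : forall x y, x \in P -> y \in P -> x != y -> 5 <= hdist x y.
Implicit Types (x y z v : vec n) (A B T p w : {set 'I_n}).

Definition blocks x := [set B : {set 'I_n} | (#|B| == 5) && (shift x B \in P)].

Definition covered x T := [exists B in blocks x, T \subset B].

(** Two distinct blocks sharing three points would give codewords at distance at most 5 + 5 - 6 =
    4. *)
Lemma block_unique x T B B' : B \in blocks x -> B' \in blocks x -> 3 <= #|T| ->
  T \subset B -> T \subset B' -> B = B'.
Proof.
rewrite !inE => /andP[/eqP cB PB] /andP[/eqP cB' PB'] cT TB TB'.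
apply/eqP; apply: contraT => neB.
have neS : shift x B != shift x B' by apply: contra neB => /eqP/(can_inj (diff_shift x))->.
have := P_dist PB PB' neS.
have := hdist_inter x (shift x B) (shift x B').
rewrite !hdist_shift !diff_shift cB cB'.
have : T \subset B :&: B' by rewrite subsetI TB.
by move/subset_leq_card; lia.
Qed.

Lemma card_blocks_containing x T : 3 <= #|T| ->
  #|[set B in blocks x | T \subset B]| = covered x T.
Proof.
move=> cT; case: (boolP (covered x T)) => [/exists_inP[B bB TB]|/exists_inPn nB].
  rewrite (_ : [set _ in _ | _] = [set B]) ?cards1 //; apply/setP=> B'.
  rewrite [LHS]inE !in_set1; apply/andP/eqP=> [[bB' TB']|->//].
  exact: block_unique bB' bB cT TB' TB.
by apply: eq_card0 => B; rewrite inE; apply/negP=> /andP[bB]; apply/negP/nB.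
Qed.

(** Double counting: a covered triple lies in only one block, so it is counted once. *)
Lemma sum_blocks_triples x (Q : pred {set 'I_n}) :
  \sum_(B in blocks x) #|[set T : {set 'I_n} | [&& Q T, #|T| == 3 & T \subset B]]|
  = #|[set T : {set 'I_n} | [&& Q T, #|T| == 3 & covered x T]]|.
Proof.
transitivity (\sum_(T : {set 'I_n} | Q T && (#|T| == 3)) (covered x T : nat)); last first.
  rewrite -big_mkcondr /= sum1_card; apply: eq_card => T; first by rewrite !inE andbA.
transitivity (\sum_(B in blocks x) \sum_(T : {set 'I_n} | Q T && (#|T| == 3)) (T \subset B : nat)).
  apply: eq_bigr => B _; rewrite -big_mkcondr /= sum1_card.
  by apply: eq_card => T; rewrite !inE andbA.
rewrite exchange_big /=; apply: eq_bigr => T /andP[_ /eqP cT].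
rewrite -card_blocks_containing ?cT // -big_mkcondr /= sum1_card.
by apply: eq_card => B; rewrite [RHS]inE.
Qed.

Lemma sum_blocks_bin3 x w :
  \sum_(B in blocks x) 'C(#|B :&: w|, 3)
  = #|[set T : {set 'I_n} | [&& T \subset w, #|T| == 3 & covered x T]]|.
Proof.
rewrite -sum_blocks_triples; apply: eq_bigr => B _.
rewrite -cards_draws; apply: eq_card => T; rewrite !inE subsetI.
by case: (T \subset B); case: (T \subset w); rewrite ?andbF ?andbT.
Qed.

(** In a block [B] through [p], a triple between [p] and [w] amounts to one of the [#|B :&: w| - 2]
    further points. *)
Lemma sum_blocks_pair x w p : p \subset w -> #|p| = 2 ->
  \sum_(B in blocks x | p \subset B) (#|B :&: w| - 2)
  = #|[set T : {set 'I_n} | [&& (p \subset T) && (T \subset w), #|T| == 3 & covered x T]]|.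
Proof.
move=> pw cp; rewrite -(sum_blocks_triples x (fun T => (p \subset T) && (T \subset w))).
rewrite big_mkcondr /=; apply: eq_bigr => B _.
case: ifP => [pB|/negP npB]; last first.
  apply/esym/eq_card0 => T; rewrite inE; apply/negP=> /and3P[/andP[pT _] _ TB].
  by case: npB; apply: subset_trans TB.
rewrite -{1}cp -card_succ_between ?subsetI ?pB // cp.
by apply: eq_card => T; rewrite !inE subsetI; do !case: (_ \subset _); rewrite ?andbF ?andbT.
Qed.

Definition far : {set vec n} := [set v | [forall x in P, 2 < hdist x v]].

(** A codeword [y] within 2 of [shift x T] has distance at most 5, hence exactly 5, from [x]; then
    [diff x y] is a block that must contain [T]. *)
Lemma uncovered_far x T : x \in P -> #|T| = 3 -> ~~ covered x T -> shift x T \in far.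
Proof.
move=> xP cT ncov; rewrite inE; apply/forall_inP=> y yP.
rewrite ltnNge; apply: contra ncov => dy.
have neq : x != y.
  by apply/eqP=> e; move: dy; rewrite -e hdist_shift cT.
have d5 := P_dist xP yP neq.
have := hdist_inter x y (shift x T); rewrite hdist_shift diff_shift cT => e.
have sTd := subset_leq_card (subsetIr (diff x y) T).
have h5 : hdist x y = 5 by lia.
apply/exists_inP; exists (diff x y); first by rewrite inE -hdistE h5 shift_diff yP.
apply/setIidPr/eqP; rewrite eqEcard subsetIr /= cT.
by rewrite -(leq_pmul2l (isT : 0 < 2)) -(leq_add2l (hdist y (shift x T))) e h5; lia.
Qed.

(** The difference sets are pairwise disjoint triples, since a common point would bring two
    codewords to distance at most 4. *)
Lemma sphere3_packing v : 3 * #|[set x in P | hdist x v == 3]| <= n.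
Proof.
pose S := [set diff v x | x in [set x in P | hdist x v == 3]].
have injd : injective (diff v) by apply: can_inj (shift_diff v).
have cS : #|S| = #|[set x in P | hdist x v == 3]| by rewrite card_imset.
have tS : trivIset S.
  apply/trivIsetP=> _ _ /imsetP[x hx ->] /imsetP[y hy ->].
  move: hx hy; rewrite !inE => /andP[xP /eqP dx] /andP[yP /eqP dy] ne.
  have nexy : x != y by apply: contra ne => /eqP->.
  have := P_dist xP yP nexy; have := hdist_inter v x y.
  rewrite !(hdistC v) dx dy -setI_eq0 -cards_eq0; lia.
have: #|cover S| <= n by rewrite -[X in _ <= X]card_ord max_card.
rewrite -(eqP tS) (eq_bigr (fun=> 3)); first by rewrite sum_nat_const cS mulnC.
by move=> _ /imsetP[x /[!inE] /andP[_ /eqP dx] ->]; rewrite -hdistE hdistC.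
Qed.

Lemma card_ball2 x : #|[set v | hdist x v <= 2]| = 1 + n + 'C(n, 2).
Proof.
rewrite (card_shift x (fun A => #|A| <= 2)).
have draws k : #|[set A : {set 'I_n} | #|A| == k]| = 'C(n, k).
  by rewrite -[in RHS](card_ord n) -cardsT -cards_draws; apply: eq_card => A; rewrite !inE subsetT.
transitivity (\sum_(A : {set 'I_n}) ((#|A| == 0) + (#|A| == 1) + (#|A| == 2))).
  rewrite -sum1_card big_mkcond; apply: eq_bigr => A _; rewrite inE.
  by case: #|A| => [|[|[|k]]].
rewrite !big_split -!big_mkcond /= !sum1dep_card !draws bin0 bin1; lia.
Qed.

(** The balls of radius 2 around codewords are pairwise disjoint and avoid [far]. *)
Lemma card_far : #|far| + #|P| * (1 + n + 'C(n, 2)) <= 2 ^ n.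
Proof.
rewrite -sum_nat_const.
rewrite (eq_bigr (fun x => #|[set v | hdist x v <= 2]|)); last by move=> x _; rewrite card_ball2.
have -> : 2 ^ n = #|{: vec n}| by rewrite card_ffun card_bool card_ord.
rewrite -(cardsC far) leq_add2l.
have -> : \sum_(x in P) #|[set v | hdist x v <= 2]| =
    \sum_(v : vec n) \sum_(x in P) (hdist x v <= 2 : nat).
  rewrite exchange_big /=; apply: eq_bigr => x _.
  by rewrite -big_mkcond /= sum1dep_card.
rewrite -sum1_card [X in _ <= X]big_mkcond /=; apply: leq_sum => v _.
case: ifP => vfar; last first.
  rewrite big1 // => x xP; move: vfar; rewrite !inE => /negbFE/forall_inP/(_ x xP).
  by rewrite ltnNge => /negbTE->.
rewrite -big_mkcondr /= sum1dep_card.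
apply/card_le1P=> x /[!inE] /andP[xP dx] y; rewrite !inE.
apply/andP/eqP => [[yP dy]|->//].
apply/eqP; apply: contraT; rewrite eq_sym => ne.
by have := P_dist xP yP ne; have := hdist_triangle v x y; rewrite !(hdistC v); lia.
Qed.

Hypothesis n3 : 3 %| n.
Hypothesis n_gt0 : 0 < n.
Hypothesis P_big : 2 ^ n.+1 <= #|P| * n.+1 ^ 2.

Definition uncov x : {set {set 'I_n}} := [set T : {set 'I_n} | (#|T| == 3) && ~~ covered x T].

(* Each block through p removes 3 of the n - 2 triples through p, and n - 2 is 1 mod 3. *)
Lemma pair_uncovered_gt0 x p : #|p| = 2 -> 0 < #|[set T in uncov x | p \subset T]|.
Proof.
move=> cp.
have cCov := sum_blocks_pair x (subsetT p) cp.
rewrite (eq_bigr (fun=> 3)) in cCov; last first.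
  by move=> B /andP[/[!inE] /andP[/eqP cB _] _]; rewrite setIT cB.
rewrite sum_nat_const in cCov.
have cAll := card_succ_between (subsetT p); rewrite cp cardsT card_ord in cAll.
set Cov := [set T | _] in cCov; set All := [set A | _] in cAll.
have : #|All| = #|Cov| + #|[set T in uncov x | p \subset T]|.
  rewrite -(cardsID Cov All); congr (_ + _); apply: eq_card => T; rewrite !inE subsetT /=.
    by case: (p \subset T); case: (_ == 3); rewrite ?andbF.
  by case: (p \subset T); case: (_ == 3); rewrite ?andbF ?andbT.
have : 2 <= n by rewrite -cp -[X in _ <= X]card_ord max_card.
lia.
Qed.

Lemma sum_pair_uncovered x :
  \sum_(p : {set 'I_n} | #|p| == 2) #|[set T in uncov x | p \subset T]| = 3 * #|uncov x|.
Proof.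
transitivity (\sum_(T in uncov x) \sum_(p : {set 'I_n} | #|p| == 2) (p \subset T : nat)).
  rewrite exchange_big /=; apply: eq_bigr => p _.
  by rewrite -big_mkcondr /= sum1_card; apply: eq_card => T; rewrite [LHS]inE.
rewrite mulnC -sum_nat_const; apply: eq_bigr => T /[!inE] /andP[/eqP cT _].
rewrite -big_mkcondr /= sum1dep_card.
rewrite -[RHS]/'C(3, 2) -cT -cards_draws; apply: eq_card => p.
by rewrite !inE andbC.
Qed.

(** Counts pairs of a codeword and a far word at distance 3 in two ways. *)
Lemma sum_uncovered : 3 * \sum_(x in P) #|uncov x| <= n * #|far|.
Proof.
apply: (@leq_trans (3 * \sum_(x in P) \sum_(v in far) (hdist x v == 3))).
  rewrite leq_mul2l /=; apply: leq_sum => x xP.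
  rewrite -(card_shift x (fun T => (#|T| == 3) && ~~ covered x T)).
  rewrite -big_mkcondr /= sum1dep_card; apply/subset_leq_card/subsetP=> v.
  rewrite !inE -hdistE => /andP[/eqP dv nc]; rewrite dv eqxx andbT.
  by have := uncovered_far xP dv nc; rewrite shift_diff inE.
rewrite exchange_big /= big_distrr /= mulnC -sum_nat_const.
apply: leq_sum => v _; apply: leq_trans (sphere3_packing v).
by rewrite leq_mul2l /= -big_mkcondr /= sum1dep_card.
Qed.

(* The counts above turn P_big into an equality, so the lower bound 1 is attained everywhere. *)
Lemma pair_uncovered x p : x \in P -> #|p| = 2 -> #|[set T in uncov x | p \subset T]| = 1.
Proof.
move=> xP /eqP cp.
pose S := \sum_(y in P) \sum_(q : {set 'I_n} | #|q| == 2) #|[set T in uncov y | q \subset T]|.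
pose S1 := \sum_(y in P) \sum_(q : {set 'I_n} | #|q| == 2) 1.
have leS : S <= S1.
  have -> : S = 3 * \sum_(x in P) #|uncov x|.
    by rewrite big_distrr; apply: eq_bigr => y _; rewrite sum_pair_uncovered.
  have -> : S1 = #|P| * 'C(n, 2).
    rewrite -sum_nat_const; apply: eq_bigr => y _; rewrite sum1dep_card.
    rewrite -[in RHS](card_ord n) -cardsT -cards_draws; apply: eq_card => A.
    by rewrite !inE subsetT.
  (* [card_far] and [P_big] give [2 * #|far| <= #|P| * n.-1], so [n * #|far|] is at most
     [#|P| * 'C(n, 2)]. *)
  apply: leq_trans sum_uncovered _.
  have := card_far; move: P_big; rewrite expnS.
  have : 2 * 'C(n, 2) = n * n.-1.
    by have := bin_ffact n 2; rewrite ffactnS ffactn1 mulnC.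
  move: n_gt0 (2 ^ n) #|P| #|far| 'C(n, 2) => + a b c d.
  by case: (n) => [//|k _] /=; rewrite expnS expn1; nia.
have pt y (q : {set 'I_n}) : (y \in P) -> #|q| == 2 -> 1 <= #|[set T in uncov y | q \subset T]|.
  by move=> _ /eqP cq; exact: (pair_uncovered_gt0 y cq).
move: leS; rewrite leqNgt => /negP nS; apply/eqP; rewrite eq_sym; apply: contraT => ne.
case: nS; rewrite /S /S1 (bigD1 x) //= [X in _ < X](bigD1 x) //= -addSn leq_add //.
  rewrite (bigD1 p) //= [X in _ < X](bigD1 p) //= -addSn leq_add //.
    by rewrite ltn_neqAle ne pt.
  by apply: leq_sum => q /andP[cq _]; apply: pt.
by apply: leq_sum => y /andP[yP _]; apply: leq_sum => q cq; apply: pt.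
Qed.

(** Each uncovered triple uses up three pairs of [w], and no pair lies in two uncovered triples. *)
Lemma uncovered_triples_le x w : x \in P ->
  3 * #|[set T in uncov x | T \subset w]| <= 'C(#|w|, 2).
Proof.
move=> xP; rewrite mulnC -sum_nat_const.
apply: (@leq_trans (\sum_(T in [set T in uncov x | T \subset w])
   \sum_(p : {set 'I_n} | (p \subset w) && (#|p| == 2)) (p \subset T))).
  apply: leq_sum => T /[!inE] /andP[/andP[/eqP cT _] Tw].
  rewrite -big_mkcondr /= sum1dep_card -[X in X <= _]/'C(3, 2) -cT -cards_draws.
  apply/subset_leq_card/subsetP=> p; rewrite !inE => /andP[pT ->].
  by rewrite pT (subset_trans pT Tw).
rewrite exchange_big /= -cards_draws -sum1dep_card.
apply: leq_sum => p /andP[pw /eqP cp]; rewrite -(pair_uncovered xP cp).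
rewrite -big_mkcondr /= sum1dep_card; apply/subset_leq_card/subsetP=> T.
by rewrite !inE => /andP[/andP[-> _] ->].
Qed.

End Packing.

(** * Codes attaining the bound *)

Section Char2.
Import GRing.Theory.
Local Open Scope ring_scope.
Variable F : finFieldType.
Hypothesis F2 : 2%N \in [pchar F].

Let two0 : 2%:R = 0 :> F. Proof. exact: pcharf0 F2. Qed.

Lemma addr_eq0_pchar2 (x y : F) : (x + y == 0) = (x == y).
Proof. by rewrite -(GRing.subr_pchar2 F2) subr_eq0. Qed.

Lemma sum_xor (I : finType) (Q v w : pred I) (g : I -> F) :
  \sum_(i | Q i && v i) g i + \sum_(i | Q i && w i) g i
  = \sum_(i | Q i && (v i != w i)) g i.
Proof.
rewrite !big_mkcondr -big_split; apply: eq_bigr => i _ /=.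
by case: (v i); case: (w i); rewrite ?addr0 ?add0r ?(addrr_pchar2 F2).
Qed.

(** Distance 6 of the extended double-error-correcting BCH code: for four elements [a, b, c, d] with
    sum 0, the sum of cubes is [(a + b) * (b + c) * (c + a)] in characteristic 2. *)
Lemma bch_even (A : {set F}) : ~~ odd #|A| -> (#|A| <= 4)%N ->
  \sum_(x in A) x = 0 -> \sum_(x in A) x ^+ 3 = 0 -> A = set0.
Proof.
move=> evA leA S1 S3; apply/cards0_eq/eqP; apply: contraT => nz.
have [c2|c4] : #|A| = 2%N \/ #|A| = 4%N by lia.
  move/eqP/cards2P: c2 => [x [y [ne eA]]]; move: S1.
  by rewrite eA big_setU1 ?inE //= big_set1 => /eqP; rewrite addr_eq0_pchar2 (negbTE ne).
have pick k (B : {set F}) : #|B| = k.+1 -> exists2 x, x \in B & #|B :\ x| = k.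
  move=> cB; have /card_gt0P[x xB] : (0 < #|B|)%N by rewrite cB.
  by exists x => //; move: cB; rewrite (cardsD1 x) xB => -[].
have [a aA c3] := pick _ _ c4; have [b bA c2] := pick _ _ c3.
move/eqP/cards2P: c2 => [c [d [ne eB]]].
have cB : c \in A :\ a :\ b by rewrite eB !inE eqxx.
have dB : d \in A :\ a :\ b by rewrite eB !inE eqxx orbT.
have exp (g : F -> F) : \sum_(x in A) g x = g a + (g b + (g c + g d)).
  by rewrite (big_setD1 a) //= (big_setD1 b) //= eB big_setU1 ?inE //= big_set1.
rewrite !exp in S1 S3; move: bA cB dB; rewrite !inE.
move=> /andP[ba _] /and3P[cb ca _] /and3P[db da _].
have ed : d = a + b + c.
  by apply/eqP; rewrite eq_sym -addr_eq0_pchar2 -!addrA S1.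
have : (a + b) * (b + c) * (c + a) = 0.
  (* The explicit multiple of 2 makes this an identity over any commutative ring, as [ring]
     requires. *)
  have -> : (a + b) * (b + c) * (c + a) = a ^+ 3 + (b ^+ 3 + (c ^+ 3 + d ^+ 3))
      - 2%:R * (a ^+ 3 + b ^+ 3 + c ^+ 3 + (a + b) * (b + c) * (c + a)).
    by rewrite ed; ring.
  by rewrite S3 two0 mul0r subr0.
move/eqP; rewrite !mulf_eq0 !addr_eq0_pchar2 (eq_sym a) (negbTE ba) (eq_sym b) (negbTE cb).
by rewrite (negbTE ca).
Qed.

Variable r : nat.
Hypothesis cardF : #|F| = (2 ^ r)%N.
Hypothesis r_odd : odd r.

(** A root satisfies [t ^+ 3 = 1]; as [r] is odd, [2 ^ r] is 2 modulo 3, so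
    [t = t ^+ (2 ^ r) = t ^+ 2], and the equation becomes [1 = 0]. *)
Lemma cyclotomic3_neq0 (t : F) : t ^+ 2 + t + 1 != 0.
Proof.
apply/eqP=> t0.
have t3 : t ^+ 3 = 1.
  have -> : t ^+ 3 = (t - 1) * (t ^+ 2 + t + 1) + 1 by ring.
  by rewrite t0 mulr0 add0r.
have [q eq] : exists q, (2 ^ r = q * 3 + 2)%N.
  exists (2 ^ r %/ 3)%N; rewrite {1}(divn_eq (2 ^ r) 3); congr (_ + _)%N.
  rewrite -(odd_double_half r) r_odd add1n expnS -mul2n expnM -modnMmr -modnXm.
  by rewrite (_ : (2 ^ 2) %% 3 = 1)%N // exp1n.
have := expf_card t; rewrite cardF eq exprD mulnC exprM t3 expr1n mul1r => t2.
by move: t0 => /eqP; rewrite t2 (addrr_pchar2 F2) add0r oner_eq0.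
Qed.

(** If [A] or [B] is empty, the equations reduce to [bch_even]. Otherwise both are pairs with the
    same sum [s], and [(x + y + al) / s] would be a root of [t ^+ 2 + t + 1]. *)
Lemma preparata_syndrome (A B : {set F}) (al : F) :
  ~~ odd #|A| -> ~~ odd #|B| -> (#|A| + #|B| <= 4)%N ->
  \sum_(x in A) x = \sum_(x in B) x ->
  \sum_(x in B) x ^+ 3 = \sum_(x in A) x ^+ 3 + al ^+ 3 + (al + \sum_(x in A) x) ^+ 3 ->
  A = set0 /\ B = set0.
Proof.
move=> evA evB le4 e1 e3.
have [A0|nA] := eqVneq A set0.
  split=> //; apply: bch_even => //; first lia.
    by rewrite -e1 A0 big_set0.
  by rewrite e3 A0 !big_set0 add0r addr0 (addrr_pchar2 F2).
have [B0|nB] := eqVneq B set0.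
  split=> //; have S0 : \sum_(x in A) x = 0 by rewrite e1 B0 big_set0.
  apply: bch_even => //; first lia.
  by move: e3; rewrite S0 B0 big_set0 addr0 -addrA (addrr_pchar2 F2) addr0.
rewrite -!cards_eq0 in nA nB.
have /eqP/cards2P[x [x' [nex eA]]] : #|A| = 2%N by lia.
have /eqP/cards2P[y [y' [ney eB]]] : #|B| = 2%N by lia.
move: e1 e3; rewrite {}eA {}eB !big_setU1 ?inE //= !big_set1 => e1 e3.
set s := x + x' in e1 e3.
have s0 : s != 0 by rewrite addr_eq0_pchar2.
have ex : x' = x + s by rewrite /s addrA (addrr_pchar2 F2) add0r.
have ey : y' = y + s by rewrite e1 addrA (addrr_pchar2 F2) add0r.
case/eqP: (cyclotomic3_neq0 ((x + y + al) / s)).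
have -> : ((x + y + al) / s) ^+ 2 + (x + y + al) / s + 1
  = s * ((x + y + al) ^+ 2 + (x + y + al) * s + s ^+ 2) / s ^+ 3 by field.
have -> : s * ((x + y + al) ^+ 2 + (x + y + al) * s + s ^+ 2)
  = (y ^+ 3 + y' ^+ 3) - (x ^+ 3 + x' ^+ 3 + al ^+ 3 + (al + s) ^+ 3)
  + 2%:R * (s * (x * y + x * al + y * al) - y ^+ 3 - y ^+ 2 * s - y * s ^+ 2
   + x ^+ 3 + 2%:R * x ^+ 2 * s + 2%:R * x * s ^+ 2 + al ^+ 3 + 2%:R * al ^+ 2 * s
   + 2%:R * al * s ^+ 2 + s ^+ 3) by rewrite ey [in RHS]ex; ring.
by rewrite e3 subrr two0 mul0r add0r mul0r.
Qed.

End Char2.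

Lemma pigeonhole (T K : finType) (f : T -> K) (k0 : K) :
  exists k, #|T| <= #|K| * #|[set v | f v == k]|.
Proof.
have K0 : 0 < #|K| by apply/card_gt0P; exists k0.
have [k ek] := eq_bigmax (fun k => #|[set v | f v == k]|) K0.
exists k; rewrite -ek -sum_nat_const -sum1_card (partition_big f predT) //=.
by apply: leq_sum => i _; rewrite sum1dep_card leq_bigmax.
Qed.

Lemma odd_card_xor (I : finType) (Q v w : pred I) :
  odd #|[set i | Q i && v i]| = odd #|[set i | Q i && w i]| ->
  ~~ odd #|[set i | Q i && (v i != w i)]|.
Proof.
have : #|[set i | Q i && v i]| + #|[set i | Q i && w i]| =
   #|[set i | Q i && (v i != w i)]| + 2 * #|[set i | Q i && (v i && w i)]|.
  rewrite -!sum1dep_card !big_mkcondr /= big_distrr /= -!big_split /=.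
  by apply: eq_bigr => i _; case: (v i); case: (w i).
lia.
Qed.

(** * The Baker - van Lint - Wilson code and its distance *)

Section Construction.
Import GRing.Theory.
Local Open Scope ring_scope.
Variables (F : finFieldType) (r N : nat) (e : 'I_N -> F * bool).
Hypothesis F2 : 2%N \in [pchar F].
Hypothesis cardF : #|F| = (2 ^ r)%N.
Hypothesis r_odd : odd r.
Hypothesis e_inj : injective e.

Definition psum b k (v : vec N) := \sum_(i | ((e i).2 == b) && v i) (e i).1 ^+ k.
Definition pparity b (v : vec N) := odd #|[set i | ((e i).2 == b) && v i]|.

(* The Baker - van Lint - Wilson description of the Preparata code: a word of length 2|F| is a
   pair (X, Y) of subsets of F, and the code is a fibre of this map. *)
Definition syndrome v : (bool * bool) * (F * F) :=
  ((pparity false v, pparity true v),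
   (psum false 1 v + psum true 1 v,
    psum false 3 v + psum false 1 v ^+ 3 + psum true 3 v)).

(** Apply [preparata_syndrome] to the sets of field elements where [v] and [w] differ in each half.
    Equal parities make both sets even, so total size at most 5 means at most 4. *)
Lemma syndrome_dist v w : syndrome v = syndrome w -> v != w -> (6 <= hdist v w)%N.
Proof.
case=> p0 p1 s1 s3 ne; rewrite ltnNge; apply: contra ne => le5.
pose U b := [set i | ((e i).2 == b) && (v i != w i)].
pose A b := [set (e i).1 | i in U b].
have injA b : {in U b &, injective (fun i => (e i).1)}.
  move=> i j; rewrite !inE => /andP[/eqP ib _] /andP[/eqP jb _] ij; apply: e_inj.
  by rewrite (surjective_pairing (e i)) (surjective_pairing (e j)) ij ib jb.
have cA b : #|A b| = #|U b| by apply: card_in_imset; apply: injA.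
have dU : hdist v w = (#|U false| + #|U true|)%N.
  rewrite /hdist -(cardsID [set i | (e i).2 == false]); congr (_ + _)%N; apply: eq_card => i.
    by rewrite !inE andbC.
  by rewrite !inE; case: (e i).2.
have ev b : ~~ odd #|A b|.
  by rewrite cA; apply: odd_card_xor; case: b.
have sA b k : psum b k v + psum b k w = \sum_(x in A b) x ^+ k.
  rewrite /psum (sum_xor F2) big_imset; last exact: injA.
  by apply: eq_bigl => i; rewrite inE.
have sA1 b : psum b 1 v + psum b 1 w = \sum_(x in A b) x.
  by rewrite sA; apply: eq_bigr.
have [] := preparata_syndrome F2 cardF r_odd (al := psum false 1 v) (ev false) (ev true).
- move: le5; rewrite dU -!cA; have := ev false; have := ev true; lia.
- apply/eqP; rewrite -(addr_eq0_pchar2 F2) -!sA1 addrACA s1.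
  by rewrite (addrr_pchar2 F2).
- rewrite -sA1 addrA (addrr_pchar2 F2) add0r -!sA; apply/eqP.
  rewrite -(addr_eq0_pchar2 F2); move/eqP: s3; rewrite -(addr_eq0_pchar2 F2) => /eqP <-.
  by apply/eqP; ring.
move=> A0 A1; rewrite -hdist_eq0 dU -!cA A0 A1 cards0 //.
Qed.

End Construction.

(** Index the coordinates by two copies of GF(2^(m-1)). The syndrome takes values in a set of size
    [4 * #|F| ^ 2 = N ^ 2], so some fibre is large enough. *)
Lemma exists_large_code m N : ~~ odd m -> 4 <= m -> N = 2 ^ m -> exists D : code N,
  (forall x y, x \in D -> y \in D -> x != y -> 6 <= hdist x y) /\
  2 ^ N <= #|D| * N ^ 2.
Proof.
move=> evm m4 eN; have [r0 rodd] : 0 < m.-1 /\ odd m.-1 by lia.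
have [F F2 cF] := pPrimePowerField (isT : prime 2) r0.
have cK : #|{: F * bool}| = N.
  by rewrite card_prod card_bool cF -expnSr prednK //; lia.
pose e (i : 'I_N) : F * bool := enum_val (cast_ord (esym cK) i).
have e_inj : injective e by move=> i j /enum_val_inj/cast_ord_inj.
have [k hk] := pigeonhole (syndrome e) ((false, false), (0%R, 0%R)).
exists [set v | syndrome e v == k]; split=> [x y|].
  rewrite !inE => /eqP ex /eqP ey; apply: (syndrome_dist F2 cF rodd e_inj).
  by rewrite ex ey.
move: hk; rewrite card_ffun card_bool card_ord !card_prod card_bool cF => /leq_trans; apply.
have eN2 : N = 2 * 2 ^ m.-1 by rewrite -expnS prednK //; lia.
by rewrite mulnC leq_mul2l; apply/orP; right; nia.
Qed.

(** * Reconstruction of distances *)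

(** The size condition reverses the Johnson bound [#|P| * n.+1 ^ 2 <= 2 ^ n.+1], so it expresses
    equality. *)
Definition nearly_perfect n (P : code n) : Prop :=
  [/\ 3 %| n, 4 <= n, forall x y, x \in P -> y \in P -> x != y -> 5 <= hdist x y
    & 2 ^ n.+1 <= #|P| * n.+1 ^ 2].

Lemma bin2E k : 2 * 'C(k.+1, 2) = k.+1 * k.
Proof. by have := bin_ffact k.+1 2; rewrite ffactnS ffactn1 mulnC. Qed.

Lemma bin3E k : 6 * 'C(k.+2, 3) = k.+2 * (k.+1 * k).
Proof. by have := bin_ffact k.+2 3; rewrite !ffactnS ffactn0 muln1 mulnC. Qed.

(** Rules out an image distance [k + 2]. Here [a] and [b] count neighbours at distances [k - 1] and
    [k - 3], whose blocks meet the image difference set in 4 and 5 points. *)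
Lemma packing_add2 k a b : 6 <= k ->
  3 * 'C(k, 3) <= 3 * (a + 4 * b) + 'C(k, 2) ->
  4 * a + 10 * b <= 'C(k + 2, 3) -> 10 * b <= 'C(k + 2, 2) * (k %/ 3) ->
  (k <= 7 -> b = 0) -> False.
Proof.
(* The polynomial estimate used for large [k] still holds at [k = 8], so 6, 7 and 8 are settled
   numerically. *)
move=> k6; have [k9|k9] := leqP 9 k; last first.
  have {k6 k9} [->|[->|->]] : k = 6 \/ k = 7 \/ k = 8 by lia.
  - rewrite (_ : 6 %/ 3 = 2) // !binS !bin0 !bin0n /=; lia.
  - rewrite (_ : 7 %/ 3 = 2) // !binS !bin0 !bin0n /=; lia.
  - rewrite (_ : 8 %/ 3 = 2) // !binS !bin0 !bin0n /=; lia.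
have [t ek] : exists t, k = t.+2 by exists k.-2; lia.
rewrite {k6}ek addn2 in k9 *.
have := bin2E t.+1; have := bin3E t; have := bin3E t.+2.
move: 'C(t.+2, 3) 'C(t.+2, 2) 'C(t.+4, 3) => x3 x2 y3 h1 h2 h3 h4 h5 _ _.
(* Ten times the lower bound and twelve times the packing bound eliminate [a] and [b]. *)
have : 5 * (6 * x3) <= 2 * (6 * y3) + 5 * (2 * x2) by lia.
by rewrite h1 h2 h3; nia.
Qed.

(** Rules out an image distance [k + 4], where neighbours at distance [k - 1] give blocks inside the
    image difference set, each with 10 triples. *)
Lemma packing_add4 k a : 6 <= k ->
  3 * 'C(k, 3) <= 3 * a + 'C(k, 2) -> 10 * a <= 'C(k + 4, 3) -> False.
Proof.
move=> k6; have [t ek] : exists t, k = t.+2 by exists k.-2; lia.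
rewrite ek addn4 in k6 *.
have := bin2E t.+1; have := bin3E t; have := bin3E t.+4.
move: 'C(t.+2, 3) 'C(t.+2, 2) 'C(t.+4.+2, 3) => x3 x2 y3 h1 h2 h3 h4 h5.
have : 10 * (6 * x3) <= 6 * y3 + 10 * (2 * x2) by lia.
by rewrite h1 h2 h3; nia.
Qed.

Lemma bin2_lt_bin3 k : 4 <= k -> 'C(k, 2) < 3 * 'C(k, 3).
Proof.
move=> k4; rewrite (mul_bin_left k 2) -[X in X < _]mul1n ltn_pmul2r; first lia.
by rewrite bin_gt0; lia.
Qed.

(** * Neighbours of a codeword, sorted by distance to another *)

Section Neighbours.
Variables (n : nat) (P : code n).
Hypothesis P_np : nearly_perfect P.
Implicit Types (x y u : vec n) (B T p w : {set 'I_n}).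

Let P_dist x y : x \in P -> y \in P -> x != y -> 5 <= hdist x y.
Proof. by case: P_np => _ _ + _; apply. Qed.

(** It involves only the distances 5 and [j], so a bijection of codes preserving these two preserves
    it. *)
Definition nbr x y j := #|[set u in P | (hdist y u == 5) && (hdist x u == j)]|.

Lemma card_blocks_meet x y i j : j + 2 * i = hdist x y + 5 ->
  #|[set B in blocks P y | #|B :&: diff y x| == i]| = nbr x y j.
Proof.
move=> eji; rewrite /nbr.
rewrite -(card_shift y (fun B => (B \in blocks P y) && (#|B :&: diff y x| == i))).
apply: eq_card => u; rewrite !inE shift_diff -hdistE.
case: (u \in P); rewrite ?andbF //= andbT.
case: eqP => //= d5; have := hdist_inter y x u; rewrite setIC d5 (hdistC y x) -eji.
by move: #|_| (hdist x u) => c d e; lia.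
Qed.

Lemma nbr0 x y j : (j + 5 < hdist x y) || ~~ odd (j + hdist x y) -> nbr x y j = 0.
Proof.
move=> h; apply: eq_card0 => u; rewrite !inE; apply/negP=> /and3P[_ /eqP d5 /eqP dj].
have := hdist_triangle u x y; rewrite (hdistC u x) (hdistC u y) d5 dj.
by have := hdist_inter y x u; rewrite d5 dj (hdistC y x); move: h; lia.
Qed.

Lemma nbr_small x y j : x \in P -> 0 < j < 5 -> nbr x y j = 0.
Proof.
move=> xP j5; apply: eq_card0 => u; rewrite !inE; apply/negP=> /and3P[uP _ /eqP dj].
have [xu|ne] := eqVneq x u; first by move: dj j5; rewrite xu hdistxx => <-.
by have := P_dist xP uP ne; lia.
Qed.

(** Intersections of size 3, 4, 5 contain 1, 4, 10 triples and lower the distance to [x] by 1, 3,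
    5. *)
Lemma sum_bin3_nbr x y : 5 <= hdist x y ->
  \sum_(B in blocks P y) 'C(#|B :&: diff y x|, 3)
  = nbr x y (hdist x y - 1) + 4 * nbr x y (hdist x y - 3) + 10 * nbr x y (hdist x y - 5).
Proof.
move=> k5.
rewrite -(@card_blocks_meet x y 3 (hdist x y - 1)); last lia.
rewrite -(@card_blocks_meet x y 4 (hdist x y - 3)); last lia.
rewrite -(@card_blocks_meet x y 5 (hdist x y - 5)); last lia.
rewrite -!sum1dep_card !big_distrr /= !big_mkcondr /= -!big_split /=.
apply: eq_bigr => B; rewrite inE => /andP[/eqP cB _].
have : #|B :&: diff y x| <= 5 by rewrite -cB; apply/subset_leq_card/subsetIl.
by move: #|_ :&: _| => [|[|[|[|[|[|c]]]]]].
Qed.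

(** Triples inside [diff y x] are covered, hence counted by neighbours, or uncovered, hence few by
    [uncovered_triples_le]. *)
Lemma nbr_lower x y : y \in P -> 5 <= hdist x y ->
  3 * 'C(hdist x y, 3) <= 3 * (nbr x y (hdist x y - 1) + 4 * nbr x y (hdist x y - 3)
     + 10 * nbr x y (hdist x y - 5)) + 'C(hdist x y, 2).
Proof.
move=> yP k5; case: P_np => n3 n4 _ Pbig.
rewrite -sum_bin3_nbr // (sum_blocks_bin3 P_dist).
have := uncovered_triples_le P_dist n3 (ltn_trans (isT : 0 < 3) n4) Pbig (diff y x) yP.
rewrite -hdistE (hdistC y x) => le; apply: leq_trans (leq_add (leqnn _) le).
rewrite -mulnDr leq_mul2l /= (hdistC x y) hdistE -cards_draws.
rewrite -(cardsID [set T | covered P y T]).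
apply: leq_add; apply/subset_leq_card/subsetP=> T; rewrite !inE.
  by case: (T \subset _); case: (_ == 3).
by case: (T \subset _); case: (_ == 3); case: (covered _ _ _).
Qed.

Lemma nbr_upper x y : 5 <= hdist x y ->
  nbr x y (hdist x y - 1) + 4 * nbr x y (hdist x y - 3) + 10 * nbr x y (hdist x y - 5)
  <= 'C(hdist x y, 3).
Proof.
move=> k5; rewrite -sum_bin3_nbr // (sum_blocks_bin3 P_dist) (hdistC x y) hdistE -cards_draws.
by apply/subset_leq_card/subsetP=> T; rewrite !inE => /and3P[-> ->].
Qed.

(** These neighbours are blocks inside [w], with 10 pairs each. Blocks through a given pair use
    disjoint sets of 3 among the other [#|w| - 2] points. *)
Lemma nbr_upper5 x y : 5 <= hdist x y ->
  10 * nbr x y (hdist x y - 5) <= 'C(hdist x y, 2) * ((hdist x y - 2) %/ 3).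
Proof.
move=> k5; rewrite -(@card_blocks_meet x y 5); last lia.
set w := diff y x; have cw : #|w| = hdist x y by rewrite -hdistE hdistC.
set S := [set B in _ | _].
have inS B : B \in S -> [/\ B \in blocks P y, #|B| = 5 & B \subset w].
  rewrite !inE => /andP[/andP[/eqP cB ->] /eqP cBw]; rewrite cB; split=> //.
  by apply/setIidPl/eqP; rewrite eqEcard subsetIl cBw cB.
rewrite -cw -cards_draws mulnC -sum_nat_const -[X in _ <= X]sum_nat_const.
apply: (@leq_trans (\sum_(B in S)
   \sum_(p : {set 'I_n} | (p \subset w) && (#|p| == 2)) (p \subset B))).
  apply: leq_sum => B /inS[_ cB Bw].
  rewrite -[10]/'C(5, 2) -cB -cards_draws -big_mkcondr /= sum1dep_card.
  apply/subset_leq_card/subsetP=> p; rewrite !inE => /andP[pB ->].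
  by rewrite pB (subset_trans pB).
rewrite exchange_big /= [X in _ <= X](eq_bigl (fun p => (p \subset w) && (#|p| == 2))); last first.
  by move=> p; rewrite inE.
apply: leq_sum => p /andP[pw /eqP cp].
rewrite leq_divRL // -big_mkcondr /= big_distrl /=.
rewrite -[X in _ - X]cp -(card_succ_between pw) cp.
apply: (@leq_trans (\sum_(B in blocks P y | p \subset B) (#|B :&: w| - 2))).
  rewrite big_mkcond [X in _ <= X]big_mkcond /=.
  apply: leq_sum => B _; case: ifP => // /andP[/inS[bB cB Bw] pB].
  by rewrite bB pB (setIidPl Bw) cB.
rewrite (sum_blocks_pair P_dist y pw cp).
by apply/subset_leq_card/subsetP=> T; rewrite !inE => /and3P[/andP[-> ->] -> _].
Qed.

(** Without blocks at [x] all triples would be uncovered, too many for [uncovered_triples_le] with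
    [w] the whole coordinate set. *)
Lemma exists_dist5 x : x \in P -> exists2 y, y \in P & hdist x y = 5.
Proof.
move=> xP; case: P_np => n3 n4 _ Pbig.
have [nB|[B]] := set_0Vmem (blocks P x); last first.
  by rewrite inE => /andP[/eqP cB sP]; exists (shift x B); rewrite ?hdist_shift.
have := uncovered_triples_le P_dist n3 (ltn_trans (isT : 0 < 3) n4) Pbig setT xP.
have -> : #|[set T in uncov P x | T \subset setT]| = 'C(n, 3).
  rewrite -[in RHS](card_ord n) -cardsT -cards_draws; apply: eq_card => T.
  rewrite !inE subsetT andbT /=; case: (_ == 3) => //=.
  by apply/exists_inPn=> B; rewrite nB inE.
by rewrite cardsT card_ord leqNgt bin2_lt_bin3.
Qed.

End Neighbours.

(** Neighbours closer to [x] than [y] is are numerous, and their counts agree with those at [x'],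
    [y']. A larger [hdist x' y'] leaves no room for them. *)
Lemma hdist_le_of_nbr n (P P' : code n) x y x' y' : nearly_perfect P -> nearly_perfect P' ->
  x \in P -> y \in P -> 6 <= hdist x y -> hdist x y <= hdist x' y' ->
  (forall j, j < hdist x y -> nbr P x y j = nbr P' x' y' j) ->
  hdist x' y' = hdist x y.
Proof.
move=> np np' xP yP; have := nbr_lower np yP.
move=> /(_ x); move e: (hdist x y) => k low k6 lek eqn.
have {}low := low (ltnW k6).
have := nbr_upper np' (x := x') (y := y'); have := nbr_upper5 np' (x := x') (y := y').
have := nbr0 P' (x := x') (y := y').
move e' : (hdist x' y') lek => k' lek z up5 up.
have {}up := up (leq_trans (ltnW k6) lek).
have {}up5 := up5 (leq_trans (ltnW k6) lek).
have [//|ne] := eqVneq k' k.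
rewrite !eqn in low; try lia.
have lt23 := bin2_lt_bin3 (ltn_trans (isT : 3 < 5) k6).
(* For an odd gap all three counts vanish by parity, so [low] contradicts [lt23]. *)
have [odk|evk] := boolP (odd (k + k')).
  by move: low; rewrite !z; lia.
have [e2|ne2] := eqVneq k' (k + 2).
  move: low up up5; rewrite {}e2 in z *.
  have -> : k + 2 - 3 = k - 1 by lia.
  have -> : k + 2 - 5 = k - 3 by lia.
  rewrite [nbr _ _ _ (k - 5)]z; last lia.
  move=> low up up5; exfalso.
  apply: (packing_add2 k6 (a := nbr P' x' y' (k - 1)) (b := nbr P' x' y' (k - 3))).
  - by move: low; lia.
  - by move: up; lia.
  - by move: up5; rewrite addnK.
  by move=> k7; rewrite -eqn; [apply: nbr_small => //; lia | lia].
have [e4|ne4] := eqVneq k' (k + 4).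
  move: low up; rewrite {}e4 in z *.
  have -> : k + 4 - 5 = k - 1 by lia.
  rewrite [nbr _ _ _ (k - 5)]z; last lia.
  rewrite [nbr _ _ _ (k - 3)]z; last lia.
  by move=> low up; exfalso; apply: (packing_add4 k6 (a := nbr P' x' y' (k - 1))); move: low up; lia.
(* The gap is now at least 6, so the triangle inequality makes all three counts vanish. *)
by move: low; rewrite !z; lia.
Qed.

Lemma nbr_transport n (P P' : code n) (f : vec n -> vec n) k x y :
  {in P &, injective f} -> f @: P = P' ->
  (forall u v, u \in P -> v \in P -> (hdist u v == 5) = (hdist (f u) (f v) == 5)) ->
  x \in P -> y \in P ->
  (forall u v, u \in P -> v \in P -> (hdist u v == k) = (hdist (f u) (f v) == k)) ->
  nbr P x y k = nbr P' (f x) (f y) k.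
Proof.
move=> f_inj fP f5 xP yP fk; rewrite /nbr -(card_in_imset (f := f)); last first.
  by move=> u v; rewrite !inE => /andP[uP _] /andP[vP _]; apply: f_inj.
apply: eq_card => v; rewrite [RHS]inE -fP; apply/imsetP/andP=> [[u]|[/imsetP[u uP ->] h]].
  by rewrite inE => /andP[uP h] ->; rewrite imset_f // -f5 // -fk.
by exists u => //; rewrite inE uP (f5 y u) // (fk x u).
Qed.

Lemma dist5_iso_isometry n (P P' : code n) (f : vec n -> vec n) :
  nearly_perfect P -> nearly_perfect P' -> {in P &, injective f} -> f @: P = P' ->
  (forall u v, u \in P -> v \in P -> (hdist u v == 5) = (hdist (f u) (f v) == 5)) ->
  forall x y, x \in P -> y \in P -> hdist (f x) (f y) = hdist x y.
Proof.
move=> np np' f_inj fP f5.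
have fP' u : u \in P -> f u \in P' by move=> uP; rewrite -fP imset_f.
(* Strong induction on [k]; the equivalence is needed in both directions so that [nbr] counts
   transfer and the other distance cannot be below [k]. *)
suff H k : forall x y, x \in P -> y \in P -> (hdist x y == k) = (hdist (f x) (f y) == k).
  by move=> x y xP yP; apply/eqP; rewrite -H.
elim/ltn_ind: k => k IH x y xP yP.
have [->|ne] := eqVneq x y; first by rewrite !hdistxx.
have nef : f x != f y by apply: contra ne => /eqP/(f_inj _ _ xP yP)->.
have d5 : 5 <= hdist x y by case: np => _ _ + _; apply.
have d5' : 5 <= hdist (f x) (f y) by case: np' => _ _ + _; apply; rewrite ?fP'.
have [k5|k5] := ltnP k 5; first by rewrite !gtn_eqF // (leq_trans k5).
have [->|k6] := eqVneq k 5; first exact: f5.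
have {k5 k6} k6 : 6 <= k by lia.
have tr j : j < k -> nbr P x y j = nbr P' (f x) (f y) j.
  by move=> jk; apply: nbr_transport => // u v uP vP; apply: IH.
apply/eqP/eqP=> d.
  rewrite -d; apply: (hdist_le_of_nbr np np') => //; rewrite ?d //.
  rewrite leqNgt; apply/negP=> lt; have := IH _ lt x y xP yP.
  by rewrite eqxx d gtn_eqF.
rewrite -d; apply: (hdist_le_of_nbr np' np); rewrite ?fP' ?d //.
  rewrite leqNgt; apply/negP=> lt; have := IH _ lt x y xP yP.
  by rewrite eqxx d gtn_eqF.
by move=> j jk; rewrite tr.
Qed.

(** * Code distance as an iterated minimum *)

Lemma bigminn_le (I : eqType) (r : seq I) (Q : pred I) (g : I -> nat) d i :
  i \in r -> Q i -> \big[minn/d]_(j <- r | Q j) g j <= g i.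
Proof.
elim: r => [|j r IH] //; rewrite inE big_cons => /orP[/eqP <-|ir] Qi.
  by rewrite Qi geq_minl.
by case: ifP => _; rewrite ?geq_min IH ?orbT.
Qed.

Lemma leq_bigminn (I : Type) (r : seq I) (Q : pred I) (g : I -> nat) d m :
  m <= d -> (forall i, Q i -> m <= g i) -> m <= \big[minn/d]_(j <- r | Q j) g j.
Proof. by move=> md mg; elim/big_ind: _ => // a b; rewrite leq_min => -> ->. Qed.

Lemma nearly_perfect_code_dist n (P : code n) : nearly_perfect P -> code_dist P = 5.
Proof.
move=> np; have [n3 n4 Pd Pbig] := np.
have /card_gt0P[x xP] : 0 < #|P|.
  by rewrite lt0n; apply: contraTneq Pbig => ->; rewrite -ltnNge expn_gt0.
have [y yP d5] := exists_dist5 np xP.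
apply/eqP; rewrite eqn_leq; apply/andP; split; last first.
  (* The default value [n.+1] of both minima is at least 5 because [4 <= n]. *)
  apply: leq_bigminn => // u uP; apply: leq_bigminn => // v /andP[vP ne].
  by apply: Pd; rewrite // eq_sym.
rewrite -d5; apply: leq_trans (bigminn_le _ _ (mem_index_enum x) xP) _.
apply: bigminn_le; first exact: mem_index_enum.
by rewrite yP; apply: contra_eq_neq d5 => ->; rewrite hdistxx.
Qed.

(** * Puncturing and the size of Preparata codes *)

Lemma hdist_puncture n (i : 'I_n.+1) x y :
  hdist x y = (x i != y i) + hdist (puncture i x) (puncture i y).
Proof.
rewrite /hdist -!sum1dep_card big_mkcond (bigD1_ord i) //=; congr (_ + _).
by rewrite [RHS]big_mkcond; apply: eq_bigr => j _; rewrite !ffunE.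
Qed.

Section Puncture.
Variables (n : nat) (C : code n.+1) (i : 'I_n.+1).
Hypothesis C_dist : forall x y, x \in C -> y \in C -> x != y -> 6 <= hdist x y.

Lemma puncture_inj : {in C &, injective (puncture i)}.
Proof.
move=> x y xC yC e; apply/eqP; apply: contraT => ne.
by have := C_dist xC yC ne; rewrite (hdist_puncture i) e hdistxx; case: (x _ != y _).
Qed.

Lemma card_puncture : #|puncture_code i C| = #|C|.
Proof. exact: card_in_imset puncture_inj. Qed.

Lemma puncture_nearly_perfect m : ~~ odd m -> 4 <= m -> n.+1 = 2 ^ m ->
  2 ^ n.+1 <= #|C| * n.+1 ^ 2 -> nearly_perfect (puncture_code i C).
Proof.
move=> evm m4 eN Cbig; split; last by rewrite card_puncture.
(* As [m] is even, [2 ^ m] is a power of 4, hence 1 modulo 3. *)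
- rewrite -[n]/(n.+1.-1) -subn1 eN -(odd_double_half m) (negbTE evm) add0n -mul2n expnM.
  rewrite -eqn_mod_dvd ?expn_gt0 // -modnXm (_ : 2 ^ 2 %% 3 = 1) //.
  by rewrite exp1n.
- have : 2 ^ 4 <= 2 ^ m by rewrite leq_exp2l.
  by rewrite -eN /=; lia.
- move=> _ _ /imsetP[x xC ->] /imsetP[y yC ->] ne.
  have nexy : x != y by apply: contra ne => /eqP->.
  by have := C_dist xC yC nexy; rewrite (hdist_puncture i); case: (x _ != y _); lia.
Qed.

End Puncture.

(** Maximality compares only with codes of minimum distance exactly 6. The constructed code attains
    6, because its puncturing has two codewords at distance 5. *)
Lemma preparata_card n (C : code n.+1) : is_preparata C -> 2 ^ n.+1 <= #|C| * n.+1 ^ 2.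
Proof.
move=> [[m [evm m4 eN]] [_ Cmax]].
have [D [Dd Dbig]] := exists_large_code evm m4 eN.
suff /Cmax le : has_min_dist D 6 by apply: leq_trans Dbig _; rewrite leq_mul2r le orbT.
split=> //; have np := puncture_nearly_perfect ord0 Dd evm m4 eN Dbig.
have /card_gt0P[x xD] : 0 < #|D|.
  by rewrite lt0n; apply: contraTneq Dbig => ->; rewrite -ltnNge expn_gt0.
have [_ /imsetP[y yD ->] d5] := exists_dist5 np (imset_f _ xD).
have ne : x != y by apply: contra_eq_neq d5 => ->; rewrite hdistxx.
exists x, y; split=> //; have := Dd _ _ xD yD ne.
by rewrite (hdist_puncture ord0) d5; case: (x _ != y _).
Qed.

Lemma punctured_preparata_nearly_perfect n (P : code n) :
  is_punctured_preparata P -> nearly_perfect P.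
Proof.
move=> [C [i [prep ->]]]; have [[m [evm m4 eN]] [[_ Cd] _]] := prep.
exact: (puncture_nearly_perfect i Cd evm m4 eN (preparata_card prep)).
Qed.

Lemma punctured_preparata_card n (P1 P2 : code n) :
  is_punctured_preparata P1 -> is_punctured_preparata P2 -> #|P2| <= #|P1|.
Proof.
move=> [C1 [i1 [[_ [[_ d1] max1]] ->]]] [C2 [i2 [[_ [min2 _]] ->]]].
by rewrite !card_puncture ?max1 //; case: min2.
Qed.

Theorem theorem1 (n : nat) (P1 P2 : code n) :
  is_punctured_preparata P1 -> is_punctured_preparata P2 ->
  (min_dist_graph_iso P1 P2 <-> isometric P1 P2).
Proof.
move=> pp1 pp2.
have np1 := punctured_preparata_nearly_perfect pp1.
have np2 := punctured_preparata_nearly_perfect pp2.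
rewrite /min_dist_graph_iso !nearly_perfect_code_dist //; split=> [[f [f_inj fP f5]]|[I [IP Id]]].
  exists f; split=> [x xP|]; first by rewrite -fP imset_f.
  exact: dist5_iso_isometry np1 np2 f_inj fP f5.
have I_inj : {in P1 &, injective I}.
  by move=> x y xP yP e; apply/eqP; rewrite -hdist_eq0 -Id // e hdistxx.
exists I; split=> // [|x y xP yP]; last by rewrite Id.
(* Both parent codes are maximal, so an injection of [P1] into [P2] is onto. *)
apply/eqP; rewrite eqEcard card_in_imset // (punctured_preparata_card pp1 pp2) andbT.
by apply/subsetP=> _ /imsetP[x xP ->]; apply: IP.
Qed.
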